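(* Let $K$ be a field and let $I\subset S=K[x_1,\dots,x_n]$, $I\ne S$, be a monomial ideal with minimal monomial generating set $G(I)=\{\mathbf{x}^{\mathbf{a}_1},\dots,\mathbf{x}^{\mathbf{a}_m}\}$. Let $L=\sum_{j=1}^m\prod_{i=1}^n L_{i,\mathbf{a}_j(i)}$ be the generalized mixed product ideal induced by $I$, where each $L_{i,\mathbf{a}_j(i)}$ is the Veronese ideal of degree $\mathbf{a}_j(i)$ in the variables $x_{i1},x_{i2},\dots,x_{im_i}$. If $I$ is a Veronese ideal, then $L$ has linear quotients.
   Context: For $\mathbf{a}_j=(\mathbf{a}_j(1),\dots,\mathbf{a}_j(n))\in\mathbb{N}^n$ write $\mathbf{x}^{\mathbf{a}_j}=x_1^{\mathbf{a}_j(1)}\cdots x_n^{\mathbf{a}_j(n)}$. The ideal $L$ lives in the polynomial ring $T=K[x_{11},\dots,x_{1m_1},x_{21},\dots,x_{2m_2},\dots,x_{n1},\dots,x_{nm_n}]$. The Veronese ideal of degree $r$ in a set of variables is the ideal generated by all monomials of degree $r$ in these variables, i.e. the $r$-th power of the ideal generated by the variables (the unit ideal if $r=0$). Thus $I$ being a Veronese ideal means $I=(x_1,\dots,x_n)^k$ for some $k$. A monomial ideal has linear quotients if its minimal monomial generators can be ordered $g_1,\dots,g_q$ such that for all $1\le i\le q-1$ the colon ideal $(g_1,\dots,g_i):g_{i+1}$ is generated by variables. *)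

(* Defs.v *)
From HB Require Import structures.
From mathcomp Require Import all_boot all_order all_algebra.
From mathcomp Require Import mpoly.

Set Implicit Arguments.
Unset Strict Implicit.
Unset Printing Implicit Defensive.

Import GRing.Theory.
Local Open Scope ring_scope.

(* Ideals are Prop-valued sets: [idealr] of ring_quotient covers only proper
   ideals with a boolean membership test. *)
Section Ideals.
Variable R : comNzRingType.
Implicit Types (I J G : R -> Prop).

Definition ideal_eq I J := forall f, I f <-> J f.

Definition ideal_gen G : R -> Prop := fun f =>
  exists2 s : seq (R * R),
    (forall p, p \in s -> G p.2) & f = \sum_(p <- s) p.1 * p.2.

Definition ideal0 : R -> Prop := fun f => f = 0.

Definition ideal1 : R -> Prop := fun=> True.

Definition ideal_add I J : R -> Prop := fun f =>
  exists g h, [/\ I g, J h & f = g + h].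

Definition ideal_mul I J : R -> Prop :=
  ideal_gen (fun f => exists g h, [/\ I g, J h & f = g * h]).

Definition ideal_colon I (g : R) : R -> Prop := fun f => I (f * g).

End Ideals.

Section MonomialIdeals.
Variables (K : fieldType) (n : nat).
Implicit Types (I : {mpoly K[n]} -> Prop) (A : 'X_{1..n} -> Prop).
Implicit Types (V : {set 'I_n}) (s : seq 'X_{1..n}).

Definition monomial_gen A : {mpoly K[n]} -> Prop :=
  ideal_gen (fun f => exists2 a, A a & f = 'X_[a]).

Definition monomial_ideal I := exists A, ideal_eq I (monomial_gen A).

Definition seq_gen s : {mpoly K[n]} -> Prop := monomial_gen (fun a => a \in s).

(* The monomials x^a, a \in s, are listed without repetition and form a
   generating set of I that is minimal for inclusion. *)
Definition minimal_generators I s :=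
  [/\ uniq s, ideal_eq I (seq_gen s) &
      forall t, {subset t <= s} -> ideal_eq I (seq_gen t) -> {subset s <= t}].

Definition variable_gen V : {mpoly K[n]} -> Prop :=
  ideal_gen (fun f => exists2 i, i \in V & f = 'X_i).

Definition veronese V (r : nat) : {mpoly K[n]} -> Prop :=
  monomial_gen (fun a => mdeg a = r /\ forall i, a i != 0%N -> i \in V).

Definition is_veronese I := exists k, ideal_eq I (veronese [set: 'I_n] k).

(* As [nth] counts from 0, [nth 0%MM g i] is the generator g_{i+1}. *)
Definition linear_quotients I :=
  exists2 g, minimal_generators I g &
    forall i, (1 <= i < size g)%N ->
      exists V, ideal_eq (ideal_colon (seq_gen (take i g)) 'X_[nth 0%MM g i])
                         (variable_gen V).

End MonomialIdeals.

(* The variables of T are indexed by 'I_(\sum_i m i), the variable x_ij being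
   'X_(tagnat.Rank i j); [var_block m i] is the i-th set of variables. *)
Definition var_block (n : nat) (m : 'I_n -> nat) (i : 'I_n) :
    {set 'I_(\sum_i m i)} :=
  [set tagnat.Rank i j | j : 'I_(m i)].

Definition mixed_product (K : fieldType) (n : nat) (m : 'I_n -> nat)
    (s : seq 'X_{1..n}) : {mpoly K[\sum_i m i]} -> Prop :=
  \big[@ideal_add _/@ideal0 _]_(a <- s)
    \big[@ideal_mul _/@ideal1 _]_(i < n) veronese (var_block m i) (a i).
Arguments mixed_product K [n] m s.

(* Main.v *)
Require Import Defs.
From HB Require Import structures.
From mathcomp Require Import all_boot all_order all_algebra.
From mathcomp Require Import mpoly.

(** The ideal [I] is the Veronese ideal of some degree [k], so its minimal
    generators are exactly the monomials of degree [k].  A product of Veronese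
    ideals in disjoint blocks of variables is generated by the monomials with
    prescribed degree in each block; letting these degrees run over all
    exponents of total degree [k], one gets every monomial of degree [k] in the
    variables of [T], since its degrees in the blocks form an exponent of degree
    [k], which is in [G].  Hence [L] is again a Veronese ideal, of degree [k] in
    all the variables of [T] ([mixed_product_veronese]).

    A Veronese ideal has linear quotients for the decreasing lexicographic
    order of its generators ([veronese_linear_quotients]).  If [x^c] precedes
    [x^b], the first exponent where they differ is some [l] with [b l < c l];
    the degrees being equal, [c j < b j] for some later [j].  Then
    [x_l * x^b / x_j] is a generator preceding [x^b], so that [x_l] is in the
    colon ideal, and [x_l] divides [x^c / gcd(x^c, x^b)].  The colon ideal at
    [x^b] is thus generated by the [x_l] such that [b j] is nonzero for some
    [j > l].

    Everything is reduced to exponents by the usual description of monomial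
    ideals ([monomial_genP]): a polynomial belongs to the ideal iff each
    exponent of its support is above an exponent of a generator. *)

Set Implicit Arguments.
Unset Strict Implicit.
Unset Printing Implicit Defensive.

Import Order.TTheory GRing.Theory.
Local Open Scope ring_scope.

(** * Ideals generated by a set *)

Section IdealGen.
Variable R : comNzRingType.
Implicit Types (G H I J : R -> Prop).

Lemma ideal_eq_sym I J : ideal_eq I J -> ideal_eq J I.
Proof. by move=> eqIJ f; split=> /eqIJ. Qed.

Lemma ideal_eq_trans J I H : ideal_eq I J -> ideal_eq J H -> ideal_eq I H.
Proof. by move=> eqIJ eqJH f; split=> [/eqIJ/eqJH | /eqJH/eqIJ]. Qed.

Lemma ideal_gen_sub G H :
  (forall f, G f -> H f) -> forall f, ideal_gen G f -> ideal_gen H f.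
Proof. by move=> GH f [s sG ->]; exists s => // p /sG/GH. Qed.

Lemma eq_ideal_gen G H :
  (forall f, G f <-> H f) -> ideal_eq (ideal_gen G) (ideal_gen H).
Proof. by move=> GH f; split; apply: ideal_gen_sub => g /GH. Qed.

Lemma ideal_gen0 G : ideal_gen G 0.
Proof. by exists [::] => //; rewrite big_nil. Qed.

Lemma ideal_genD G f g : ideal_gen G f -> ideal_gen G g -> ideal_gen G (f + g).
Proof.
move=> [s sG ->] [t tG ->]; exists (s ++ t); last by rewrite big_cat.
by move=> p; rewrite mem_cat => /orP[/sG | /tG].
Qed.

Lemma ideal_genM G f g : G g -> ideal_gen G (f * g).
Proof.
by move=> Gg; exists [:: (f, g)]; rewrite ?big_seq1 // => p /[!inE] /eqP->.
Qed.

Lemma ideal_gen_id G f : G f -> ideal_gen G f.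
Proof. by move=> Gf; rewrite -[f]mul1r; apply: ideal_genM. Qed.

Lemma eq_ideal_mul I J I' J' : ideal_eq I I' -> ideal_eq J J' ->
  ideal_eq (ideal_mul I J) (ideal_mul I' J').
Proof.
move=> eqI eqJ; apply: eq_ideal_gen => f.
by split=> -[g [h [/eqI Ig /eqJ Jh ->]]]; exists g, h.
Qed.

Lemma eq_ideal_add I J I' J' : ideal_eq I I' -> ideal_eq J J' ->
  ideal_eq (ideal_add I J) (ideal_add I' J').
Proof.
by move=> eqI eqJ f; split=> -[g [h [/eqI Ig /eqJ Jh ->]]]; exists g, h.
Qed.

End IdealGen.

(** * Monomial ideals *)

Section MonomialGen.
Variables (K : fieldType) (n : nat).
Implicit Types (A B : 'X_{1..n} -> Prop) (f g : {mpoly K[n]}).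

(** A monomial ideal contains all the monomials of its elements, so membership
    amounts to divisibilities between monomials. *)
Lemma monomial_genP A f :
  monomial_gen A f <->
  (forall u, u \in msupp f -> exists2 a, A a & (a <= u)%MM).
Proof.
split.
  case=> s + ->; elim: s => [|p s IHs] sA u.
    by rewrite big_nil msupp0.
  rewrite big_cons => /msuppD_le; rewrite mem_cat => /orP[|]; last first.
    by apply: IHs => q qs; apply: sA; rewrite inE qs orbT.
  have [a Aa ->] := sA p (mem_head _ _).
  rewrite (perm_mem (msuppMX _ _)) => /mapP[v _ ->].
  by exists a => //; apply: lem_addr.
move=> suppA; rewrite (mpolyE f) big_seq.
apply: (big_ind (monomial_gen A)) => [||u /suppA [a Aa le_au]].
- exact: ideal_gen0.
- exact: ideal_genD.
rewrite -(submK le_au) mpolyXD scalerAl.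
by apply: ideal_genM; exists a.
Qed.

Lemma monomial_genX A u :
  monomial_gen A ('X_[u] : {mpoly K[n]}) <-> exists2 a, A a & (a <= u)%MM.
Proof.
rewrite monomial_genP msuppX; split=> [|ex v /[!inE] /eqP-> //].
by apply; rewrite inE.
Qed.

Lemma eq_monomial_gen A B : (forall a, A a <-> B a) ->
  ideal_eq (monomial_gen A : {mpoly K[n]} -> Prop) (monomial_gen B).
Proof.
by move=> AB; apply: eq_ideal_gen => f; split=> -[a /AB Ba ->]; exists a.
Qed.

Lemma monomial_gen0 :
  ideal_eq (@ideal0 {mpoly K[n]}) (monomial_gen (fun=> False)).
Proof.
move=> f; split=> [->|/monomial_genP f0]; first exact: ideal_gen0.
rewrite /ideal0 (mpolyE f) big_seq big1 // => u /f0 [a []].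
Qed.

Lemma monomial_gen1 :
  ideal_eq (@ideal1 {mpoly K[n]}) (monomial_gen (fun a => a = 0%MM)).
Proof.
move=> f; split=> // _; apply/monomial_genP => u _; exists 0%MM => //.
by apply/mnm_lepP => i; rewrite mnm0E.
Qed.

Lemma monomial_genU A B :
  ideal_eq (ideal_add (monomial_gen A) (monomial_gen B) : {mpoly K[n]} -> Prop)
           (monomial_gen (fun a => A a \/ B a)).
Proof.
move=> f; split.
  move=> [g [h [Ag Bh ->]]]; apply: ideal_genD.
    by apply: ideal_gen_sub Ag => _ [a Aa ->]; exists a; auto.
  by apply: ideal_gen_sub Bh => _ [a Ba ->]; exists a; auto.
case=> s + ->; elim: s => [|p s IHs] sAB.
  by exists 0, 0; rewrite big_nil addr0; split=> //; apply: ideal_gen0.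
rewrite big_cons; have [|g [h [Ag Bh ->]]] := IHs.
  by move=> q qs; apply: sAB; rewrite inE qs orbT.
have [a + ->] := sAB p (mem_head _ _); case=> [Aa | Ba].
  exists (p.1 * 'X_[a] + g), h; split=> //; last by rewrite addrA.
  by apply: ideal_genD => //; apply: ideal_genM; exists a.
exists g, (p.1 * 'X_[a] + h); split=> //; last by rewrite addrCA.
by apply: ideal_genD => //; apply: ideal_genM; exists a.
Qed.

Lemma monomial_genM A B :
  ideal_eq (ideal_mul (monomial_gen A) (monomial_gen B) : {mpoly K[n]} -> Prop)
           (monomial_gen (fun c => exists a b, [/\ A a, B b & c = (a + b)%MM])).
Proof.
move=> f; split.
  case=> s + ->; elim: s => [|p s IHs] sAB.
    by rewrite big_nil; apply: ideal_gen0.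
  rewrite big_cons; apply: ideal_genD; last first.
    by apply: IHs => q qs; apply: sAB; rewrite inE qs orbT.
  have [g [h [/monomial_genP Ag /monomial_genP Bh ->]]] := sAB p (mem_head _ _).
  rewrite mulrA; apply/monomial_genP => t /msuppM_le /allpairsP[[w v] /=].
  move=> [wpg /Bh [b Bb le_bv] ->].
  have /allpairsP[[w' u] /= [_ /Ag [a Aa le_au] ->]] := msuppM_le wpg.
  exists (a + b)%MM; first by exists a, b.
  apply/mnm_lepP => i; rewrite !mnmDE leq_add ?(mnm_lepP le_bv) //.
  by rewrite (leq_trans (mnm_lepP le_au i)) ?leq_addl.
apply: ideal_gen_sub => _ [_ [a [b [Aa Bb ->]]] ->].
exists 'X_[a], 'X_[b]; rewrite mpolyXD.
by split=> //; apply: ideal_gen_id; [exists a | exists b].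
Qed.

Lemma monomial_gen_sum (I : eqType) (r : seq I)
    (F : I -> {mpoly K[n]} -> Prop) (A : I -> 'X_{1..n} -> Prop) :
    (forall i, ideal_eq (F i) (monomial_gen (A i))) ->
  ideal_eq (\big[@ideal_add _/@ideal0 _]_(i <- r) F i)
           (monomial_gen (fun a => exists2 i, i \in r & A i a)).
Proof.
move=> FA; elim: r => [|i r IHr].
  rewrite big_nil; apply: ideal_eq_trans monomial_gen0 _.
  by apply: eq_monomial_gen => a; split=> // -[].
rewrite big_cons; apply: ideal_eq_trans (eq_ideal_add (FA i) IHr) _.
apply: ideal_eq_trans (monomial_genU _ _) _; apply: eq_monomial_gen => a.
split=> [[Aia | [j jr Aja]] | [j /[!inE] /predU1P[-> | jr] Aja]].
- by exists i; rewrite ?mem_head.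
- by exists j; rewrite ?inE ?jr ?orbT.
- by left.
- by right; exists j.
Qed.

Lemma monomial_gen_prod (I : finType)
    (F : I -> {mpoly K[n]} -> Prop) (A : I -> 'X_{1..n} -> Prop) :
    (forall i, ideal_eq (F i) (monomial_gen (A i))) ->
  ideal_eq (\big[@ideal_mul _/@ideal1 _]_i F i)
    (monomial_gen (fun a => exists2 c : I -> 'X_{1..n},
                     forall i, A i (c i) & a = (\sum_i c i)%MM)).
Proof.
move=> FA.
(* In a list without repetition, the exponent chosen at the head is independent
   of those chosen in the tail. *)
have gen r : uniq r -> ideal_eq (\big[@ideal_mul _/@ideal1 _]_(i <- r) F i)
    (monomial_gen (fun a => exists2 c : I -> 'X_{1..n},
       forall i, i \in r -> A i (c i) & a = (\sum_(i <- r) c i)%MM)).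
  elim: r => [_|i r IHr /= /andP[ir /IHr{}IHr]].
    rewrite big_nil; apply: ideal_eq_trans monomial_gen1 _.
    apply: eq_monomial_gen => a; split=> [->|[c _ ->]]; last by rewrite big_nil.
    by exists (fun=> 0%MM); rewrite ?big_nil.
  rewrite big_cons; apply: ideal_eq_trans (eq_ideal_mul (FA i) IHr) _.
  apply: ideal_eq_trans (monomial_genM _ _) _; apply: eq_monomial_gen => a.
  split=> [[b [_ [Ab [c Ac ->] ->]]] | [c Ac ->]].
    exists (fun j => if j == i then b else c j) => [j /[!inE] |].
      by case: eqP => [-> // | _ /= /Ac].
    rewrite big_cons eqxx; congr (_ + _)%MM; apply: eq_big_seq => j jr.
    by case: eqP => // ji; rewrite -ji jr in ir.
  exists (c i), (\sum_(j <- r) c j)%MM; split; rewrite ?big_cons //.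
    by apply: Ac; rewrite mem_head.
  by exists c => // j jr; apply: Ac; rewrite inE jr orbT.
apply: ideal_eq_trans (gen _ (index_enum_uniq I)) _.
apply: eq_monomial_gen => a; split=> -[c Ac ->]; exists c => // i.
by apply: Ac; rewrite mem_index_enum.
Qed.

End MonomialGen.

(** * Veronese ideals *)

Section Veronese.
Variables (K : fieldType) (n k : nat).
Implicit Types (a b c u : 'X_{1..n}) (s : seq 'X_{1..n}).

Lemma veroneseT : ideal_eq (veronese [set: 'I_n] k : {mpoly K[n]} -> Prop)
                           (monomial_gen (fun a => mdeg a = k)).
Proof.
by apply: eq_monomial_gen => a; split=> [[] //|dega]; split=> // i; rewrite inE.
Qed.

Lemma lem_mdeg_eq a b : (a <= b)%MM -> mdeg a = mdeg b -> a = b.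
Proof.
move=> le_ab; rewrite -[in mdeg b](submK le_ab) mdegD => /eqP.
rewrite -{1}[mdeg a]add0n eqn_add2r eq_sym mdeg_eq0 => /eqP b_a.
by rewrite -(submK le_ab) b_a add0m.
Qed.

(** Distinct monomials of the same degree do not divide each other, so a
    generating set must contain all monomials of degree [k]; these generate the
    ideal, so by minimality it contains no other. *)
Lemma veronese_minimal_generators (I : {mpoly K[n]} -> Prop) s :
    ideal_eq I (veronese [set: 'I_n] k) ->
  minimal_generators I s <-> uniq s /\ forall a, (a \in s) = (mdeg a == k).
Proof.
move=> verI; have eqI := ideal_eq_trans verI veroneseT.
have degS t : ideal_eq I (seq_gen t) -> forall a, mdeg a = k -> a \in t.
  move=> eqt a dega.
  have /eqt/monomial_genX[b bt le_ba]: I 'X_[a].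
    by apply/eqI/monomial_genX; exists a => //; apply: lepm_refl.
  have /eqI/monomial_genX[c degc le_cb]: I 'X_[b].
    by apply/eqt/monomial_genX; exists b => //; apply: lepm_refl.
  have eq_ca : c = a.
    by apply: lem_mdeg_eq (lepm_trans le_cb le_ba) _; rewrite degc.
  suff -> : a = b by [].
  apply/mnmP => i; apply/eqP; rewrite eqn_leq (mnm_lepP le_ba) andbT.
  by rewrite -[in leqLHS]eq_ca (mnm_lepP le_cb).
split=> [[uniqs eqs mins] | [uniqs degs]].
  split=> // a; apply/idP/eqP => [|/degS -> //].
  suff /[apply]: {subset s <= [seq b <- s | mdeg b == k]}.
    by rewrite mem_filter => /andP[/eqP].
  apply: mins => [b|]; first by rewrite mem_filter => /andP[].
  apply: ideal_eq_trans eqI _; apply: eq_monomial_gen => b.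
  rewrite mem_filter; split=> [degb|/andP[/eqP //]].
  by rewrite degb eqxx degS.
split=> // [|t _ /degS degt a]; last by rewrite degs => /eqP/degt.
apply: ideal_eq_trans eqI _; apply: eq_monomial_gen => a.
by rewrite degs; split=> /eqP.
Qed.

(** The witness [l] is the first index where [b] and [c] differ.  If [b]
    vanished after [l], it would be at most [c] everywhere and smaller at [l],
    against the equality of degrees. *)
Lemma ltmc_exchange b c : mdeg b = mdeg c -> (b < c)%O ->
  exists2 l, (b l < c l)%N & exists2 j : 'I_n, (l < j)%N & b j != 0%N.
Proof.
move=> degbc /(ltmcP degbc)[l eqbc ltbc]; exists l => //.
have [/existsP[j /andP[]]|/existsPn no_j] :=
  boolP [exists j : 'I_n, (l < j)%N && (b j != 0%N)]; first by exists j.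
suff: (mdeg b < mdeg c)%N by rewrite degbc ltnn.
rewrite !mdegE (bigD1 l) // [X in (_ < X)%N](bigD1 l) //= -addSn leq_add //.
apply: leq_sum => i il; have [ltil|lti] := ltnP i l; first by rewrite eqbc.
have: (l < i)%N by rewrite ltn_neqAle lti andbT eq_sym.
by move=> lti'; have := no_j i; rewrite lti' /= negbK => /eqP->.
Qed.

(** Converse of the previous lemma: moving one unit of degree from [j] to an
    earlier [l] increases [b], so [x_l] is in the colon ideal at [x^b]. *)
Lemma exchange_ltmc b (l j : 'I_n) : (l < j)%N -> b j != 0%N ->
  let c := (b - U_(j) + U_(l))%MM in
  [/\ mdeg c = mdeg b, (b < c)%O & (c <= U_(l) + b)%MM].
Proof.
move=> ltlj bj /=.
have le_jb : (U_(j) <= b)%MM by rewrite lep1mP.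
have degc : mdeg (b - U_(j) + U_(l))%MM = mdeg b.
  by rewrite -[in RHS](submK le_jb) !mdegD !mdeg1.
split=> //; last first.
  by apply/mnm_lepP => i; rewrite !mnmDE mnmBE addnC leq_add2l leq_subr.
apply/ltmcP; first by rewrite degc.
exists l => [i ltil|]; rewrite mnmDE mnmBE !mnm1E.
  have -> : j == i = false.
    by apply/eqP=> ji; move: ltil; rewrite -ji ltnNge ltnW.
  have -> : l == i = false by apply/eqP=> li; move: ltil; rewrite -li ltnn.
  by rewrite subn0 addn0.
have -> : j == l = false by apply/eqP=> ji; move: ltlj; rewrite -ji ltnn.
by rewrite eqxx subn0 addn1.
Qed.

(** The exponents [c] below are those of the generators listed before [b], and
    the two exchange lemmas give one inclusion each. *)
Lemma veronese_colon b : mdeg b = k ->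
  ideal_eq (ideal_colon
              (monomial_gen (fun c => mdeg c = k /\ (b < c)%O)) 'X_[b])
    (variable_gen [set l : 'I_n | [exists j : 'I_n, (l < j)%N && (b j != 0%N)]]
      : {mpoly K[n]} -> Prop).
Proof.
move=> degb; set V := [set l | _].
have varE : ideal_eq (variable_gen V : {mpoly K[n]} -> Prop)
    (monomial_gen (fun a => exists2 l, l \in V & a = U_(l)%MM)).
  apply: eq_ideal_gen => f; split=> [[l lV ->]|[_ [l lV ->] ->]].
    by exists U_(l)%MM => //; exists l.
  by exists l.
move=> f; split=> [/monomial_genP fb|/varE/monomial_genP fV].
  apply/varE/monomial_genP => u uf.
  have [|c [degc lt_bc] le_cu] := fb (b + u)%MM.
    by rewrite (perm_mem (msuppMX _ _)) map_f.
  have [|l ltl [j ltlj bj]] := ltmc_exchange _ lt_bc; first by rewrite degc.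
  exists U_(l)%MM; first exists l => //.
    by rewrite inE; apply/existsP; exists j; apply/andP.
  rewrite lep1mP; apply: contraTneq ltl => ul.
  by rewrite -leqNgt; move/mnm_lepP/(_ l): le_cu; rewrite mnmDE ul addn0.
apply/monomial_genP => w; rewrite (perm_mem (msuppMX _ _)) => /mapP[u uf ->].
have [_ [l + ->] le_lu] := fV u uf; rewrite inE => /existsP[j /andP[ltlj bj]].
have [degc ltbc le_c] := exchange_ltmc ltlj bj.
exists (b - U_(j) + U_(l))%MM; first by rewrite degc.
apply: lepm_trans le_c _; rewrite addmC.
by apply/mnm_lepP => i; rewrite !mnmDE leq_add2l (mnm_lepP le_lu).
Qed.

End Veronese.

(** Turns the prefixes in the definition of linear quotients into conditions on
    the monomial order. *)
Lemma mem_take_sorted (T : eqType) (r : rel T) (x0 : T) (s : seq T)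
    (i : nat) x :
    transitive r -> irreflexive r -> sorted r s -> (i < size s)%N ->
  (x \in take i s) = (x \in s) && r x (nth x0 s i).
Proof.
move=> r_tr r_irr s_sorted lti; apply/idP/andP => [xi|[xs rxi]].
  have xs := mem_take xi; split=> //; rewrite -[x in r x _](nth_index x0 xs).
  apply: (sorted_ltn_nth r_tr) => //; rewrite ?inE ?index_mem //.
  by move: xi; rewrite in_take.
rewrite in_take // ltnNge; apply/negP; rewrite leq_eqVlt => /predU1P[ix|ltix].
  by move: rxi; rewrite ix nth_index // r_irr.
have := sorted_ltn_nth r_tr x0 s_sorted i (index x s) lti.
rewrite inE index_mem nth_index // => /(_ xs ltix).
by move=> /(r_tr _ _ _ rxi); rewrite r_irr.
Qed.

Lemma enum_mdeg n k :
  exists2 s : seq 'X_{1..n}, uniq s & forall a, (a \in s) = (mdeg a == k).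
Proof.
exists [seq val b | b <- enum [pred b : 'X_{1..n < k.+1} | mdeg b == k]].
  by rewrite map_inj_uniq ?enum_uniq //; apply: val_inj.
move=> a; apply/mapP/eqP => [[b]|dega].
  by rewrite mem_enum => /eqP degb ->.
have lta : (mdeg a < k.+1)%N by rewrite dega.
by exists (BMultinom lta) => //; rewrite mem_enum; apply/eqP.
Qed.

Lemma veronese_linear_quotients (K : fieldType) n k :
  linear_quotients (veronese [set: 'I_n] k : {mpoly K[n]} -> Prop).
Proof.
have [s uniqs degs] := enum_mdeg n k.
pose g := rev (sort <=%O s).
have degg a : (a \in g) = (mdeg a == k) by rewrite mem_rev mem_sort degs.
have sortg : sorted >%O g by rewrite rev_sorted sort_lt_sorted.
exists g => [|i /andP[_ ltig]].
  by apply/(@veronese_minimal_generators _ _ k); rewrite // rev_uniq sort_uniq.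
set b := nth _ _ _.
have degb : mdeg b = k by apply/eqP; rewrite -degg mem_nth.
exists [set l : 'I_n | [exists j : 'I_n, (l < j)%N && (b j != 0%N)]].
apply: ideal_eq_trans (veronese_colon degb) => f.
apply: eq_monomial_gen => c; rewrite (mem_take_sorted 0%MM _ _ _ sortg) //.
- by rewrite degg; split=> [/andP[/eqP]|[-> /= ->]]; rewrite ?eqxx.
- by move=> x y z /= lt1 lt2; apply: lt_trans lt2 lt1.
- by move=> x /=; rewrite ltxx.
Qed.

(** * Generalized mixed products *)

Lemma mem_var_block n (m : 'I_n -> nat) i l :
  (l \in var_block m i) = (tagnat.sig1 l == i).
Proof.
apply/imsetP/eqP => [[j _ ->]|<-]; first by rewrite tagnat.Rank1K.
by exists (tagnat.sig2 l) => //; rewrite tagnat.sig2K.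
Qed.

(** Only the degree of a monomial is left: any distribution of it among the
    blocks is an exponent of [s]. *)
Lemma mixed_product_veronese (K : fieldType) n (m : 'I_n -> nat)
    (s : seq 'X_{1..n}) k : (forall a, (a \in s) = (mdeg a == k)) ->
  ideal_eq (mixed_product K m s) (veronese [set: _] k).
Proof.
move=> degs.
have prodE (a : 'X_{1..n}) := monomial_gen_prod
  (fun i => (fun=> iff_refl _)
     : ideal_eq (veronese (var_block m i) (a i) : {mpoly K[_]} -> Prop) _).
apply: ideal_eq_trans (monomial_gen_sum s prodE) _.
apply: ideal_eq_trans (ideal_eq_sym (@veroneseT _ _ _)).
apply: eq_monomial_gen => c; split=> [[a + [d dega ->]]|degc].
  rewrite degs mdeg_sum mdegE => /eqP <-.
  by apply: eq_bigr => i _; case: (dega i).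
(* [d i] is the part of [c] in the [i]-th block. *)
pose d i := [multinom (tagnat.sig1 l == i) * c l | l < \sum_i m i]%N.
have cE : c = (\sum_i d i)%MM.
  apply/mnmP => l; rewrite mnm_sumE [RHS](bigD1 (tagnat.sig1 l)) //=.
  rewrite mnmE eqxx mul1n.
  rewrite [X in (_ + X)%N]big1 ?addn0 // => i /negPf il.
  by rewrite mnmE eq_sym il.
exists [multinom mdeg (d i) | i < n].
  by rewrite degs mdegE -degc cE mdeg_sum; under eq_bigr do rewrite mnmE.
exists d => // i; split=> [|l]; first by rewrite mnmE.
by rewrite mem_var_block mnmE; case: (_ == i).
Qed.

Theorem theorem3p3 (K : fieldType) (n : nat) (m : 'I_n -> nat)
    (I : {mpoly K[n]} -> Prop) (G : seq 'X_{1..n}) :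
  monomial_ideal I ->
  ~ ideal_eq I (@ideal1 _) ->
  minimal_generators I G ->
  is_veronese I ->
  linear_quotients (mixed_product K m G).
Proof.
move=> _ _ minG [k verI].
have [_ degG] := (veronese_minimal_generators _ verI).1 minG.
have eqL := mixed_product_veronese (K := K) (m := m) degG.
have [g [uniqg eqg ming] colong] := veronese_linear_quotients K (\sum_i m i) k.
exists g => //; split=> // [|t tg eqt].
  exact: ideal_eq_trans eqL eqg.
by apply: ming => //; apply: ideal_eq_trans (ideal_eq_sym eqL) eqt.
Qed.
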